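(* For every $\epsilon>0$ and every positive integer $m$ there is a positive integer $M$ such that every graph $G$ with at least $M$ vertices has an $(\epsilon)$-regular partition $\mathcal P$ with $|\mathcal P|\in[m,M]$.
   Context: For a graph $G$ and disjoint nonempty $X,Y\subset V(G)$, $e(X,Y)$ is the number of edges with one end in $X$ and the other in $Y$, and $d(X,Y)=e(X,Y)/(|X||Y|)$. The density of $G$ is $d=e(G)/\binom{|G|}{2}$. A pair $(X,Y)$ is $(\epsilon,p)$-regular if for all $X'\subset X$, $Y'\subset Y$ with $|X'|\ge\epsilon|X|$, $|Y'|\ge\epsilon|Y|$, we have $|d(X',Y')-d(X,Y)|<\epsilon p$. A partition $V(G)=V_0\cup V_1\cup\cdots\cup V_k$ with designated exceptional set $V_0$ (possibly empty) is balanced if $|V_i|=|V_j|$ for all $i,j\ge1$; it is $(\epsilon)$-regular if it is balanced, $|V_0|<\epsilon|G|$, and all but at most $\epsilon k^2$ pairs $(V_i,V_j)$ with $i>j\ge1$ are $(\epsilon,d)$-regular, where $d$ is the density of $G$. For such a partition $\mathcal P$, $|\mathcal P|=k$ (the number of nonexceptional classes).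
   Formalization: The graph G is assumed to have at least one edge; for edgeless G the density d is 0, the strict inequality in regularity fails for every pair of classes when ε ≤ 1, and the claim is false (e.g. ε = 1/4, m = 3). *)

(* Defs.v *)
(* MathComp; the real numbers are an arbitrary R : realType. *)
From mathcomp Require Import all_boot all_order all_algebra.
From mathcomp Require Import reals.

Set Implicit Arguments.
Unset Strict Implicit.
Unset Printing Implicit Defensive.

Import Order.TTheory GRing.Theory Num.Theory.
Local Open Scope ring_scope.

(* A finite simple graph is a symmetric irreflexive relation [E] on a finType
   [V]; its edges are the two-element sets [set x; y] with [E x y]. *)
Section Graph.
Variables (V : finType) (E : rel V).
Implicit Types X Y : {set V}.

Definition edges_between X Y : {set {set V}} :=
  [set [set x; y] | x in X, y in Y & E x y].

Definition edges : {set {set V}} := edges_between [set: V] [set: V].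

Variable R : realType.

Definition pair_density X Y : R :=
  #|edges_between X Y|%:R / (#|X|%:R * #|Y|%:R).

Definition density : R := #|edges|%:R / 'C(#|V|, 2)%:R.

(* The inequality is strict, so no pair of nonempty sets is (eps, 0)-regular
   when eps <= 1. *)
Definition regular_pair (eps p : R) X Y : bool :=
  [forall X' : {set V}, forall Y' : {set V},
    [&& X' \subset X, Y' \subset Y,
        eps * #|X|%:R <= #|X'|%:R & eps * #|Y|%:R <= #|Y'|%:R] ==>
    (`|pair_density X' Y' - pair_density X Y| < eps * p)].

End Graph.

(* [P] lists V_0, V_1, ..., V_k. The class [P ord0] is the exceptional one, and
   the only one that may be empty. *)
Record exceptional_partition (V : finType) (k : nat)
    (P : 'I_k.+1 -> {set V}) : Prop := {
  expart_cover : \bigcup_i P i = [set: V];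
  expart_disjoint : forall i j, i != j -> [disjoint P i & P j];
  expart_nonempty : forall i, i != ord0 -> P i != set0
}.

Definition balanced (V : finType) (k : nat) (P : 'I_k.+1 -> {set V}) : Prop :=
  forall i j, i != ord0 -> j != ord0 -> #|P i| = #|P j|.

Definition irregular_pairs (V : finType) (E : rel V) (R : realType) (eps : R)
    (k : nat) (P : 'I_k.+1 -> {set V}) : {set 'I_k.+1 * 'I_k.+1} :=
  [set ij : 'I_k.+1 * 'I_k.+1 | (0 < ij.2 < ij.1)%N &
            ~~ regular_pair E eps (density E R) (P ij.1) (P ij.2)].

Record regular_partition (V : finType) (E : rel V) (R : realType) (eps : R)
    (k : nat) (P : 'I_k.+1 -> {set V}) : Prop := {
  regpart_partition : exceptional_partition P;
  regpart_balanced : balanced P;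
  regpart_exceptional : #|P ord0|%:R < eps * #|V|%:R;
  regpart_irregular : #|irregular_pairs E eps P|%:R <= eps * k%:R ^+ 2
}.

(* Main.v *)
Require Import Defs.
From mathcomp Require Import all_boot all_order all_algebra.
From mathcomp Require Import reals.
From mathcomp Require Import ring lra zify.

Set Implicit Arguments.
Unset Strict Implicit.
Unset Printing Implicit Defensive.

Import Order.TTheory GRing.Theory Num.Theory.
Local Open Scope ring_scope.

(* Energy increment, with a truncated energy in place of the mean square density.
   Weight each adjacent ordered pair of vertices by 1/d, so that the total weight
   is at most n^2. The energy of a partition sums phi over the cell averages of
   the weight, where phi is quadratic up to K ~ 8/eps and linear beyond. Because
   phi grows linearly, the energy is at most 2 K n^2 however sparse the graph is.
   By averaging, only few pairs have relative density above 8/eps; every other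
   irregular pair lies where phi is strictly convex, so refining by its witnesses
   raises the energy. Hence the number of refinements depends on eps only.
   Vertices of the exceptional set count as singleton cells: discarding vertices
   to equalise the classes is then itself a refinement and costs no energy. *)

(** * Truncated energy of a partition *)

Section Energy.
Variables (R : realFieldType) (U : finType) (w : U -> R).

Definition mean (S : {set U}) : R := (\sum_(u in S) w u) / #|S|%:R.

Definition fiber (J : eqType) (f : U -> J) (j : J) : {set U} :=
  [set u | f u == j].

Lemma sum_mean (S : {set U}) : \sum_(u in S) w u = #|S|%:R * mean S.
Proof.
have [->|S0] := eqVneq S set0; first by rewrite big_set0 cards0 mul0r.
by rewrite mulrC divfK // pnatr_eq0 cards_eq0.
Qed.

(** Averaging over cells is the orthogonal projection onto the functions constant on cells, so
    pairing with such an [h] cannot tell [w] from its averages. *)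
Lemma sum_fiber_mean (J : finType) (f : U -> J) (h : U -> R) :
    (forall u v, f u = f v -> h u = h v) ->
  \sum_u h u * mean (fiber f (f u)) = \sum_u h u * w u.
Proof.
move=> hf; rewrite (partition_big f predT) //= [RHS](partition_big f predT) //=.
apply: eq_bigr => j _.
have [u0 /eqP fu0 | no_j] := pickP (fun u => f u == j); last first.
  by rewrite !big1 // => u; rewrite no_j.
transitivity (\sum_(u in fiber f j) h u0 * mean (fiber f j)).
  apply: eq_big => [u | u /eqP fu]; first by rewrite inE.
  by rewrite fu (hf u u0) // fu fu0.
rewrite sumr_const -mulr_natl mulrCA -sum_mean mulr_sumr.
apply: eq_big => [u | u]; first by rewrite inE.
by rewrite inE => /eqP fu; rewrite (hf u u0) // fu fu0.
Qed.

Variable K : R.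

Definition truncated_mean (J : eqType) (f : U -> J) (u : U) : R :=
  Num.min (mean (fiber f (f u))) K.

(* By [sum_fiber_mean] this is the sum over [u] of [phi (mean (fiber f (f u)))],
   where [phi t] is [t ^+ 2] for [t <= K] and continues linearly, with slope
   [2 * K], for [t >= K]. *)
Definition energy (J : eqType) (f : U -> J) : R :=
  \sum_u (2 * truncated_mean f u * w u - truncated_mean f u ^+ 2).

Lemma truncated_mean_const (J : eqType) (f : U -> J) u v :
  f u = f v -> truncated_mean f u = truncated_mean f v.
Proof. by rewrite /truncated_mean => ->. Qed.

(** The energy is the maximum of a concave functional over the functions bounded by [K] and constant
    on cells, attained at the truncated mean. A refinement only enlarges the set of competitors. *)
Lemma energy_max (J : finType) (f : U -> J) (s : U -> R) :
    (forall u v, f u = f v -> s u = s v) -> (forall u, s u <= K) ->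
  \sum_u (2 * s u * w u - s u ^+ 2) <= energy f.
Proof.
move=> sf sK.
(* For [t] constant on cells, [w] may be replaced by its cell averages; the comparison is then
   pointwise. *)
have condE t : (forall u v, f u = f v -> t u = t v) ->
    \sum_u (2 * t u * w u - t u ^+ 2) =
    \sum_u (2 * t u * mean (fiber f (f u)) - t u ^+ 2).
  move=> tf; rewrite !sumrB; congr (_ - _); apply/esym/sum_fiber_mean.
  by move=> u v /tf->.
rewrite /energy (condE s) // (condE (truncated_mean f)); last first.
  exact: truncated_mean_const.
apply: ler_sum => u _; have := sK u; rewrite /truncated_mean.
set c := mean _; case: (leP c K) => cK sKu.
  have := sqr_ge0 (c - s u); nra.
(* This product is the difference of the two sides when the mean [c] exceeds [K]. *)
have : 0 <= (K - s u) * (2 * c - K - s u) by apply: mulr_ge0; lra.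
nra.
Qed.

Lemma energy_ge0 (J : finType) (f : U -> J) : 0 <= K -> 0 <= energy f.
Proof.
move=> K0; have := @energy_max J f (fun=> 0) (fun _ _ _ => erefl) (fun=> K0).
by rewrite big1 // => u _; rewrite mulr0 mul0r expr0n subrr.
Qed.

Lemma energy_le (J : eqType) (f : U -> J) :
  (forall u, 0 <= w u) -> energy f <= 2 * K * \sum_u w u.
Proof.
move=> w0; rewrite mulr_sumr; apply: ler_sum => u _.
have : truncated_mean f u <= K by rewrite /truncated_mean ge_min lexx orbT.
move=> tK; have := sqr_ge0 (truncated_mean f u).
have := w0 u; nra.
Qed.

(* Raise or lower the truncated means of [f] by [eps] on the sets [W j]: the
   result is still admissible in [energy_max] for the finer labelling [f']. *)
Lemma energy_gain (J J' : finType) (f : U -> J) (f' : U -> J')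
    (I : {set J}) (W : J -> {set U}) (eps del : R) :
    0 <= eps ->
    (forall u v, f' u = f' v -> f u = f v) ->
    (forall j, j \in I -> W j \subset fiber f j) ->
    (forall u v, f' u = f' v -> f u \in I -> u \in W (f u) -> v \in W (f u)) ->
    (forall j, j \in I -> mean (fiber f j) <= K - eps) ->
    (forall j, j \in I -> eps <= `|mean (W j) - mean (fiber f j)|) ->
    (forall j, j \in I -> del <= #|W j|%:R) ->
  energy f + eps ^+ 2 * del * #|I|%:R <= energy f'.
Proof.
move=> eps0 ref Wsub Winv sparse dev Wbig.
(* The shift points from the mean of the cell towards the mean of [W j]. *)
pose sg j := if mean (fiber f j) <= mean (W j) then eps else - eps.
have sgE j : sg j ^+ 2 = eps ^+ 2.
  by rewrite /sg; case: ifP => // _; rewrite sqrrN.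
pose lam u := if (f u \in I) && (u \in W (f u)) then sg (f u) else 0.
have lam_const u v : f' u = f' v -> lam u = lam v.
  move=> e; rewrite /lam (ref _ _ e); case: ifP.
    case/andP=> vI uW; rewrite vI /= -(ref _ _ e) (Winv _ _ e) //.
      by rewrite (ref _ _ e).
    by rewrite (ref _ _ e).
  case: (boolP (f v \in I)) => //= vI uW; case: ifP => // vW.
  by have := Winv v u (esym e) vI vW; rewrite uW.
set s := fun u => truncated_mean f u + lam u.
have := @energy_max _ f' s.
have -> : \sum_u (2 * s u * w u - s u ^+ 2) = energy f +
   \sum_u (2 * lam u * (w u - truncated_mean f u) - lam u ^+ 2).
  rewrite /energy -big_split /=; apply: eq_bigr => u _; rewrite /s; ring.
move=> maxs; apply: le_trans (maxs _ _); last 2 first.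
- by move=> u v e; rewrite /s (lam_const _ _ e) (truncated_mean_const (ref _ _ e)).
- move=> u; rewrite /s /lam; case: ifP => [/andP[uI _]|_]; last first.
    by rewrite addr0 /truncated_mean ge_min lexx orbT.
  have : truncated_mean f u <= K - eps.
    by apply: le_trans (sparse _ uI); rewrite /truncated_mean ge_min lexx.
  by rewrite /sg; case: ifP => _; lra.
rewrite lerD2l (partition_big f predT) //= (bigID (mem I)) /=.
rewrite [X in _ <= _ + X]big1 ?addr0; last first.
  move=> j jI; apply: big1 => u /eqP fu.
  by rewrite /lam fu (negbTE jI) /=; ring.
rewrite -[#|I|]sum1_card natr_sum mulr_sumr; apply: ler_sum => j jI.
rewrite mulr1 (bigID (mem (W j))) /= [X in _ <= _ + X]big1 ?addr0; last first.
  move=> u /andP[/eqP fu uW].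
  by rewrite /lam fu (negbTE uW) andbF; ring.
rewrite (eq_bigl (fun u => u \in W j)); last first.
  move=> u /=; case: (boolP (u \in W j)); rewrite ?andbF ?andbT // => uW.
  by have := subsetP (Wsub _ jI) _ uW; rewrite inE.
(* On a cell of [I] the truncation is inactive, because the mean is at most [K - eps]. *)
rewrite (eq_bigr (fun u =>
   2 * sg j * w u - (2 * sg j * mean (fiber f j) + eps ^+ 2))); last first.
  move=> u uW; have := subsetP (Wsub _ jI) _ uW; rewrite inE => /eqP fu.
  rewrite /lam fu jI uW /= sgE /truncated_mean fu min_l; first by ring.
  by apply: le_trans (sparse _ jI) _; lra.
rewrite sumrB -mulr_sumr sum_mean sumr_const -[X in _ - X]mulr_natl.
have := Wbig _ jI; have := dev _ jI.
set a := mean (W j); set b := mean (fiber f j) => dj Wj.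
have {}dj : eps ^+ 2 <= sg j * (a - b).
  rewrite /sg -/a -/b; case: ifP => ab.
    by rewrite expr2 ler_wpM2l //; move: dj; rewrite ger0_norm // subr_ge0.
  rewrite mulNr -mulrN expr2 ler_wpM2l //; move: dj.
  by rewrite ler0_norm // subr_le0 ltW // ltNge ab.
have W0 : 0 <= #|W j|%:R :> R by [].
set c := #|W j|%:R : R.
(* Since [eps ^+ 2 <= sg j * (a - b)], the linear gain is at least twice the quadratic cost
   [eps ^+ 2]. *)
have -> : 2 * sg j * (c * a) - c * (2 * sg j * b + eps ^+ 2) =
  c * (2 * (sg j * (a - b)) - eps ^+ 2) by ring.
rewrite mulrC; apply: (@le_trans _ _ (c * eps ^+ 2)).
  by rewrite ler_wpM2r // sqr_ge0.
by rewrite ler_wpM2l //; lra.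
Qed.

End Energy.

(** * Refining equal-size classes *)

Lemma card_eq_subset (V : finType) (A : {set V}) (s : nat) :
  (s <= #|A|)%N -> exists2 B : {set V}, B \subset A & #|B| = s.
Proof.
move=> sA; exists [set x in take s (enum A)].
  by apply/subsetP=> x; rewrite inE => /mem_take; rewrite mem_enum.
rewrite cardsE; move/card_uniqP: (take_uniq s (enum_uniq A)) => ->.
by rewrite size_take -cardE; case: ltngtP sA.
Qed.

(** Cut off [s] points of one colour as long as some colour has that many left; in the end each of
    the at most [N] colours leaves fewer than [s] points over. *)
Lemma monochromatic_split (V T : finType) (c : V -> T) (s N : nat)
    (A : {set V}) :
    (0 < s)%N -> (#|c @: A| <= N)%N ->
  exists Q : {set {set V}},
    [/\ trivIset Q, cover Q \subset A, forall B, B \in Q -> #|B| = s,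
        forall B, B \in Q -> {in B &, forall x y, c x = c y}
      & (#|A :\: cover Q| <= N * s)%N].
Proof.
move=> s_gt0; have [n] := ubnP #|A|; elim: n A => // n IHn A An cA.
have [t big_t | small] := pickP (fun t => s <= #|A :&: fiber c t|)%N; last first.
  exists set0; split; rewrite ?/trivIset /cover ?big_set0 ?cards0 ?sub0set //;
    try by move=> B; rewrite inE.
  rewrite setD0 -sum1_card (partition_big_imset c) /=.
  apply: (@leq_trans (\sum_(t in c @: A) s)); last first.
    by rewrite sum_nat_const leq_mul2r cA orbT.
  apply: leq_sum => t _; move/negbT: (small t); rewrite -ltnNge => /ltnW.
  apply: leq_trans; rewrite sum1_card; apply: subset_leq_card.
  by apply/subsetP=> x; rewrite !inE.
have [B BAt sB] := card_eq_subset big_t.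
have /andP[BA Bt] : (B \subset A) && (B \subset fiber c t) by rewrite -subsetI.
have [||Q [tQ QA sQ mQ lQ]] := IHn (A :\: B).
- by have := cardsID B A; rewrite (setIidPr BA); lia.
- by apply: leq_trans cA; apply/subset_leq_card/imsetS/subsetDl.
have dBQ : [disjoint B & cover Q].
  have := subset_trans QA (subsetDr _ _).
  by rewrite -disjoints_subset disjoint_sym.
have cQ : cover (B |: Q) = B :|: cover Q.
  rewrite /cover; apply/setP=> x; rewrite inE.
  apply/bigcupP/orP => [[C /setU1P[->|CQ] xC]|[xB|/bigcupP[C CQ xC]]].
  - by left.
  - by right; apply/bigcupP; exists C.
  - by exists B; rewrite ?setU11.
  - by exists C; rewrite // setU1r.
exists (B |: Q); split.
- apply/trivIsetP=> C D /setU1P[->|CQ] /setU1P[->|DQ]; rewrite ?eqxx // => CD.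
  + by apply: disjointWr dBQ; apply: (bigcup_max D).
  + by rewrite disjoint_sym; apply: disjointWr dBQ; apply: (bigcup_max C).
  + by move/trivIsetP: tQ; apply.
- by rewrite cQ subUset BA (subset_trans QA) ?subsetDl.
- by move=> C /setU1P[->|/sQ].
- move=> C /setU1P[->|/mQ//] x y xB yB.
  by move: (subsetP Bt _ xB) (subsetP Bt _ yB); rewrite !inE => /eqP-> /eqP->.
- by rewrite cQ -setDDl.
Qed.

Definition block_label (V : finType) (Q : {set {set V}}) (x : V) : {set V} :=
  if x \in cover Q then pblock Q x else [set x].

Section BlockLabel.
Variables (V : finType) (Q : {set {set V}}).
Hypothesis tQ : trivIset Q.

Lemma mem_block_label x : x \in block_label Q x.
Proof. by rewrite /block_label; case: ifP; rewrite ?mem_pblock ?set11. Qed.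

Lemma block_label_def A x : A \in Q -> x \in A -> block_label Q x = A.
Proof.
move=> AQ xA; rewrite /block_label (def_pblock tQ AQ xA) ifT //.
by apply/bigcupP; exists A.
Qed.

Lemma fiber_block_label A : A \in Q -> fiber (block_label Q) A = A.
Proof.
move=> AQ; apply/setP=> x; rewrite inE; apply/eqP/idP => [<-|].
  exact: mem_block_label.
exact: block_label_def.
Qed.

(** Outside [cover Q] the labels are singletons, so equal labels there mean equal points. Hence
    discarded points do not spoil a refinement. *)
Lemma block_label_mono (T : Type) (c : V -> T) x y :
    (forall B, B \in Q -> {in B &, forall x y, c x = c y}) ->
  block_label Q x = block_label Q y -> c x = c y.
Proof.
move=> mQ exy; have := mem_block_label x; have := mem_block_label y.
rewrite -exy /block_label; case: ifP => [xQ | _].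
  by move=> yB xB; apply: mQ xB yB; apply: pblock_mem.
by rewrite inE => /eqP->.
Qed.

Lemma card_cover_uniform s :
  (forall B, B \in Q -> #|B| = s) -> #|cover Q| = (#|Q| * s)%N.
Proof.
move=> sQ; rewrite -(eqP tQ) -sum_nat_const.
by apply: eq_bigr => B /sQ.
Qed.

End BlockLabel.

(** * The energy increment *)

Section Refinement.
Variables (R : realFieldType) (V : finType) (w : V * V -> R) (eps : R).
Implicit Types (Q : {set {set V}}) (p q : {set V} * {set V}).

Definition rect_mean p : R := mean w (setX p.1 p.2).

(** Failure of regularity with the density normalised to 1: when [w] is the adjacency divided by
    [d], a deviation of [eps * d] becomes [eps]. *)
Definition irregular_witness p q : bool :=
  [&& q.1 \subset p.1, q.2 \subset p.2, eps * #|p.1|%:R <= #|q.1|%:R,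
      eps * #|p.2|%:R <= #|q.2|%:R & eps <= `|rect_mean q - rect_mean p|].

Definition irregular p : bool := [exists q, irregular_witness p q].

Definition pair_label Q (u : V * V) : {set V} * {set V} :=
  (block_label Q u.1, block_label Q u.2).

Lemma fiber_pair_label Q p :
  trivIset Q -> p \in setX Q Q -> fiber (pair_label Q) p = setX p.1 p.2.
Proof.
case: p => A B tQ; rewrite inE /= => /andP[AQ BQ]; apply/setP=> -[x y].
rewrite !inE xpair_eqE -{2}(fiber_block_label tQ AQ).
by rewrite -{2}(fiber_block_label tQ BQ) !inE.
Qed.

(** Colour each vertex by its block and its position relative to all chosen witnesses, then cut the
    cover into monochromatic blocks of size [s']: every witness rectangle becomes a union of
    cells. *)
Lemma refine_step Q (s s' : nat) (K : R) :
    0 <= eps -> trivIset Q -> (forall A, A \in Q -> #|A| = s) -> (0 < s')%N ->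
  exists Q' : {set {set V}},
    [/\ trivIset Q', cover Q' \subset cover Q, forall A, A \in Q' -> #|A| = s',
        (#|cover Q :\: cover Q'| <= #|Q| * 4 ^ #|Q| * s')%N
      & energy w K (pair_label Q) + eps ^+ 2 * (eps * s%:R) ^+ 2 *
          #|[set p in setX Q Q | irregular p & rect_mean p <= K - eps]|%:R
        <= energy w K (pair_label Q')].
Proof.
move=> eps0 tQ sQ s'0.
pose W p := odflt (set0, set0) [pick q | irregular_witness p q].
have WP p : irregular p -> irregular_witness p (W p).
  rewrite /W; case: pickP => [q //|no /existsP[q]]; by rewrite no.
(* For [x] in a block [A]: the block itself, the [B] with [x] on the first side of the witness of
   [(A, B)], and the [B] with [x] on the second side of the witness of [(B, A)]. *)
pose code x := (block_label Q x, [set B in Q | x \in (W (block_label Q x, B)).1],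
  [set B in Q | x \in (W (B, block_label Q x)).2]).
have card_code : (#|code @: cover Q| <= #|Q| * 4 ^ #|Q|)%N.
  (* A code is a block together with two subsets of [Q]. *)
  rewrite (_ : #|Q| * _ = #|setX (setX Q (powerset Q)) (powerset Q)|)%N; last first.
    by rewrite !cardsX !card_powerset -mulnA -expnMn.
  apply/subset_leq_card/subsetP=> _ /imsetP[x xQ ->].
  rewrite !in_setX !powersetE /= {1}/block_label xQ pblock_mem //=.
  by apply/andP; split; apply/subsetP=> B; rewrite inE => /andP[].
have [Q' [tQ' Q'Q sQ' mQ' lQ']] := monochromatic_split s'0 card_code.
exists Q'; split => //.
have code_const x y : block_label Q' x = block_label Q' y -> code x = code y.
  exact: block_label_mono.
have ref u v : pair_label Q' u = pair_label Q' v -> pair_label Q u = pair_label Q v.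
  by case=> /code_const[e1 _ _] /code_const[e2 _ _]; rewrite /pair_label e1 e2.
set I := [set p in _ | _].
have IP p : p \in I -> [/\ p \in setX Q Q, irregular_witness p (W p),
    fiber (pair_label Q) p = setX p.1 p.2 & rect_mean p <= K - eps].
  rewrite inE => /andP[pQ /andP[/WP ip dp]].
  by split => //; apply: fiber_pair_label.
apply: (energy_gain (W := fun p => setX (W p).1 (W p).2)) => //.
- move=> p /IP[_ /and5P[s1 s2 _ _ _] -> _].
  apply/subsetP=> -[x y].
  by rewrite !inE => /andP[/(subsetP s1)-> /(subsetP s2)->].
(* The code of [u.1] decides the first side of the witness, the code of [u.2] the second. *)
- move=> u v e uI; have := ref _ _ e; case: e => /code_const e1 /code_const e2.
  have [uQ _ _ _] := IP _ uI; case=> l1 l2; rewrite !inE => /andP[u1 u2].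
  move: uQ; rewrite inE /= => /andP[uQ1 uQ2].
  case: e1 => _ /setP/(_ (block_label Q u.2)) + _.
  case: e2 => _ _ /setP/(_ (block_label Q u.1)).
  rewrite -l2 -l1 !inE uQ1 uQ2 /=.
  by rewrite u2 => <-; rewrite u1 => <-.
- by move=> p /IP[_ _ -> dp].
- by move=> p /IP[_ /and5P[_ _ _ _ dev] -> _].
- move=> p /IP[+ /and5P[_ _ w1 w2 _] _ _]; rewrite inE => /andP[p1 p2].
  rewrite cardsX natrM expr2; apply: ler_pM; rewrite ?mulr_ge0 //.
    by rewrite -(sQ _ p1).
  by rewrite -(sQ _ p2).
Qed.

(** Markov's inequality: the rectangles are disjoint, and each dense one carries weight at least
    [D * s%:R ^+ 2]. *)
Lemma card_dense_pairs Q (s : nat) (D : R) :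
    (forall u, 0 <= w u) -> 0 <= D ->
    trivIset Q -> (forall A, A \in Q -> #|A| = s) ->
  D * s%:R ^+ 2 * #|[set p in setX Q Q | D < rect_mean p]|%:R <= \sum_u w u.
Proof.
move=> w0 D0 tQ sQ; set I := [set p in _ | _].
rewrite (partition_big (pair_label Q) predT) //= (bigID (mem I)) /=.
rewrite -[leLHS]addr0; apply: lerD; last first.
  by apply: sumr_ge0 => p _; apply: sumr_ge0.
rewrite -sum1_card natr_sum mulr_sumr; apply: ler_sum => p.
rewrite inE => /andP[pQ dp]; rewrite mulr1.
have -> : \sum_(u | pair_label Q u == p) w u = \sum_(u in setX p.1 p.2) w u.
  by apply: eq_bigl => u; rewrite -(fiber_pair_label tQ pQ) [in RHS]inE.
rewrite sum_mean cardsX; move: pQ; rewrite inE => /andP[p1 p2].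
by rewrite (sQ _ p1) (sQ _ p2) natrM mulrC expr2 ler_wpM2l ?mulr_ge0 // ltW.
Qed.

End Refinement.

(** * Iterating the increment *)

Section Iteration.
Variables (R : realFieldType) (V : finType) (w : V * V -> R) (eps : R).
Hypotheses (eps_gt0 : 0 < eps) (w_ge0 : forall u, 0 <= w u).
Hypothesis w_sum : \sum_u w u <= #|V|%:R ^+ 2.

(** Pairs of mean at most [8 / eps] keep the room [eps] below [K] that a shift needs. If the blocks
    cover half of [V], at most [eps / 2 * #|Q|%:R ^+ 2] pairs are denser. *)
Let K : R := 8 / eps + eps.

Definition irregular_in (Q : {set {set V}}) : {set {set V} * {set V}} :=
  [set p in setX Q Q | irregular w eps p].

Lemma card_sparse_irregular (Q : {set {set V}}) (s : nat) :
    trivIset Q -> (forall A, A \in Q -> #|A| = s) -> (0 < s)%N ->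
    (#|V| <= 2 * #|Q| * s)%N -> eps * #|Q|%:R ^+ 2 < #|irregular_in Q|%:R ->
  eps / 2 * #|Q|%:R ^+ 2 <=
    #|[set p in setX Q Q | irregular w eps p & rect_mean w p <= K - eps]|%:R.
Proof.
move=> tQ sQ s_gt0 nQ irr.
have D_ge0 : 0 <= 8 / eps by apply: divr_ge0 => //; apply: ltW.
have := card_dense_pairs w_ge0 D_ge0 tQ sQ.
set I := [set p in _ | _ & _]; set J := [set p in _ | _] => dense.
have IJ : (#|irregular_in Q| <= #|I| + #|J|)%N.
  apply: leq_trans (leq_card_setU I J); apply/subset_leq_card/subsetP=> p.
  by rewrite !inE -andb_orr /K addrK => /andP[-> ->] /=; case: leP.
have {}dense : #|J|%:R <= eps / 2 * #|Q|%:R ^+ 2 :> R.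
  have s2 : 0 < s%:R ^+ 2 :> R by rewrite exprn_gt0 ?ltr0n.
  rewrite -(ler_pM2l s2) -(ler_pM2l (_ : 0 < 8 / eps)) ?divr_gt0 //.
  rewrite mulrA; apply: le_trans dense _; apply: le_trans w_sum _.
  have -> : 8 / eps * (s%:R ^+ 2 * (eps / 2 * #|Q|%:R ^+ 2)) =
            (2 * #|Q|%:R * s%:R) ^+ 2 by field; rewrite gt_eqF.
  by rewrite ler_sqr ?nnegrE ?mulr_ge0 // -!natrM ler_nat.
have : #|irregular_in Q|%:R <= #|I|%:R + #|J|%:R :> R by rewrite -natrD ler_nat.
move: irr dense; set a := _ ^+ 2; lra.
Qed.

(** Refining to block size about [s / (4 ^ #|Q| * L)] discards at most [#|V| / L] vertices. Only the
    energy gain is conditional on irregularity, so the same step also cuts the trivial partition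
    into small blocks. *)
Lemma increment_step (Q : {set {set V}}) (s L : nat) :
    trivIset Q -> (forall A, A \in Q -> #|A| = s) ->
    (0 < #|V|)%N -> (0 < L)%N ->
    (#|V| <= 2 * #|Q| * s)%N -> (2 * #|Q| * 4 ^ #|Q| * L <= #|V|)%N ->
  exists (Q' : {set {set V}}) (s' : nat),
    [/\ [/\ trivIset Q', forall A, A \in Q' -> #|A| = s' & (0 < s')%N],
        (L * (#|V| - #|Q'| * s') <= L * (#|V| - #|Q| * s) + #|V|)%N,
        (#|Q'| <= 4 * #|Q| * 4 ^ #|Q| * L)%N,
        (s' * L <= #|V|)%N
      & eps * #|Q|%:R ^+ 2 < #|irregular_in Q|%:R ->
        energy w K (pair_label Q) + eps ^+ 5 / 8 * #|V|%:R ^+ 2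
          <= energy w K (pair_label Q')].
Proof.
move=> tQ sQ n_gt0 L_gt0 nQ Vbig.
have k_gt0 : (0 < #|Q|)%N by case: #|Q| nQ n_gt0 => //; lia.
have s_gt0 : (0 < s)%N by case: s nQ {sQ} n_gt0 => //; lia.
have p_gt0 : (0 < 4 ^ #|Q|)%N by rewrite expn_gt0.
pose r := (4 ^ #|Q| * L)%N.
have r_gt0 : (0 < r)%N by rewrite muln_gt0 p_gt0.
(* The lower bound on [#|V|] ensures that the new block size is not zero. *)
have rs : (r <= s)%N.
  have : (2 * #|Q| * r <= 2 * #|Q| * s)%N.
    by apply: leq_trans nQ; rewrite /r mulnA.
  by rewrite leq_pmul2l // muln_gt0.
pose s' := (s %/ r)%N.
have s'_gt0 : (0 < s')%N by rewrite divn_gt0.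
have [Q' [tQ' QQ' sQ' lQ' enQ']] := refine_step w K (ltW eps_gt0) tQ sQ s'_gt0.
have cQ := card_cover_uniform tQ sQ; have cQ' := card_cover_uniform tQ' sQ'.
have kn : (#|Q| * s <= #|V|)%N by rewrite -cQ max_card.
have kn' : (#|Q'| * s' <= #|Q| * s)%N by rewrite -cQ -cQ' subset_leq_card.
have s'r : (s' * r <= s)%N by apply: leq_trunc_div.
have ss' : (s < s'.+1 * r)%N by apply: ltn_ceil.
exists Q', s'; split => //.
- move: lQ'; rewrite cardsD (setIidPr QQ') cQ cQ' => lQ'.
  have lost : (L * (#|Q| * 4 ^ #|Q| * s') <= #|V|)%N.
    apply: leq_trans kn; rewrite [leqLHS](_ : _ = #|Q| * (s' * r))%N.
      by rewrite leq_mul2l s'r orbT.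
    by rewrite /r; move: (s') (4 ^ #|Q|)%N => t p; lia.
  have e : (#|V| - #|Q'| * s' =
      (#|V| - #|Q| * s) + (#|Q| * s - #|Q'| * s'))%N by lia.
  rewrite e mulnDr leq_add2l; apply: leq_trans lost.
  by rewrite leq_mul2l lQ' orbT.
(* Rounding costs at most a factor 2, as [s < s'.+1 * r <= 2 * s' * r]. *)
- rewrite -(leq_pmul2r s'_gt0); apply: leq_trans kn' _.
  have -> : (4 * #|Q| * 4 ^ #|Q| * L * s' = #|Q| * (4 * (s' * r)))%N by
    rewrite /r; move: (s') (4 ^ #|Q|)%N => t p; lia.
  by rewrite leq_mul2l; apply/orP; right; nia.
- apply: leq_trans kn; apply: (@leq_trans s); last by rewrite leq_pmull.
  by apply: leq_trans s'r; rewrite /r leq_mul2l leq_pmull ?orbT.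
have sq_ge0 : 0 <= eps ^+ 2 * (eps * s%:R) ^+ 2 by rewrite mulr_ge0 ?sqr_ge0.
move=> irr; apply: le_trans enQ'; rewrite lerD2l.
have := card_sparse_irregular tQ sQ s_gt0 nQ irr.
move/(ler_wpM2l sq_ge0); apply: le_trans.
have -> : eps ^+ 2 * (eps * s%:R) ^+ 2 * (eps / 2 * #|Q|%:R ^+ 2) =
          eps ^+ 5 / 8 * (2 * #|Q|%:R * s%:R) ^+ 2 by field.
apply: ler_wpM2l; first by rewrite divr_ge0 // exprn_ge0 // ltW.
by rewrite ler_sqr ?nnegrE ?mulr_ge0 // -!natrM ler_nat.
Qed.

End Iteration.

(** A tower-type recursion following the block count of [increment_step] from a single block. *)
Definition class_bound (L i : nat) : nat :=
  iter i (fun k => 4 * k * 4 ^ k * L)%N 1%N.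

Lemma class_bound_leS L i :
  (0 < L)%N -> (class_bound L i <= class_bound L i.+1)%N.
Proof.
move=> L0; rewrite /class_bound iterS; set k := iter _ _ _.
have : (0 < 4 ^ k)%N by rewrite expn_gt0.
by move: (4 ^ k)%N => p p0; rewrite -!mulnA mulnCA leq_pmulr // !muln_gt0 p0 L0.
Qed.

Lemma leq_class_bound L i j :
  (0 < L)%N -> (i <= j)%N -> (class_bound L i <= class_bound L j)%N.
Proof.
by move=> L0; apply: (homo_leq (@leqnn) leq_trans) => n; apply: class_bound_leS.
Qed.

Lemma class_bound_step L i k :
  (k <= class_bound L i)%N -> (4 * k * 4 ^ k * L <= class_bound L i.+1)%N.
Proof.
by move=> kN; rewrite leq_mul2r leq_mul ?leq_mul2l ?leq_exp2l ?kN ?orbT.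
Qed.

Theorem weighted_regularity (R : archiRealFieldType) (eps : R) (m : nat) :
    0 < eps ->
  exists M : nat, forall (V : finType) (w : V * V -> R),
    (forall u, 0 <= w u) -> \sum_u w u <= #|V|%:R ^+ 2 ->
    (M <= #|V|)%N -> (0 < #|V|)%N ->
  exists (Q : {set {set V}}) (s : nat),
    [/\ [/\ trivIset Q, forall A, A \in Q -> #|A| = s & (0 < s)%N],
        (m <= #|Q| <= M)%N, #|~: cover Q|%:R < eps * #|V|%:R
      & #|irregular_in w eps Q|%:R <= eps * #|Q|%:R ^+ 2].
Proof.
move=> eps_gt0; pose K : R := 8 / eps + eps; pose c : R := eps ^+ 5 / 8.
have K_gt0 : 0 < K by rewrite addr_gt0 ?divr_gt0.
have c_gt0 : 0 < c by rewrite divr_gt0 ?exprn_gt0.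
(* After [T] gains of [c * n%:R ^+ 2] the energy would exceed its upper bound
   [2 * K * n%:R ^+ 2]. *)
pose T := Num.bound (2 * K / c).
have T_large : 2 * K < T%:R * c.
  rewrite -ltr_pdivrMr //; apply: archi_boundP.
  by rewrite ltW // divr_gt0 // mulr_gt0.
(* The summands serve, in turn, to keep half of the vertices covered through all rounds, to force at
   least [m] blocks, and to keep the exceptional set below [eps * n]. *)
pose L := (2 * T.+1 + 2 * m + Num.bound (T.+1%:R / eps))%N.
have L_gt0 : (0 < L)%N by rewrite /L; lia.
have TL : (2 * T.+1 <= L)%N by rewrite /L; lia.
have mL : (2 * m <= L)%N by rewrite /L; lia.
have L_large : T.+1%:R < eps * L%:R.
  rewrite mulrC -ltr_pdivrMr //.
  apply: (@lt_le_trans _ _ (Num.bound (T.+1%:R / eps : R))%:R).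
    by apply: archi_boundP; rewrite divr_ge0 // ltW.
  by rewrite ler_nat /L; lia.
(* One level above the largest block count reached, so that even the last refinement has enough
   vertices. *)
exists (class_bound L T.+2) => V w w_ge0 w_sum Vbig n_gt0.
set n := #|V| in Vbig n_gt0 w_sum *.
set G := exists Q, _.
have half j q : (j <= T)%N -> (L * (n - q) <= j.+1 * n)%N -> (n <= 2 * q)%N.
  move=> jT nq; have : (L * (n - q) * 2 <= L * n)%N.
    apply: (@leq_trans (j.+1 * n * 2)); first by rewrite leq_mul2r nq orbT.
    by rewrite mulnAC leq_mul2r (leq_trans _ TL) ?orbT // mulnC leq_mul2l ltnS.
  by rewrite -mulnA leq_pmul2l //; lia.
have enough_room i k : (i <= T)%N -> (k <= class_bound L i.+1)%N ->
    (2 * k * 4 ^ k * L <= n)%N.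
  move=> iT /class_bound_step kN.
  have iT2 : (i.+2 <= T.+2)%N by [].
  apply: leq_trans (leq_trans (leq_class_bound L_gt0 iT2) Vbig).
  by apply: leq_trans kN; rewrite -!mulnA leq_mul2r orbT.
(* Blocks of size at most [n / L] that cover half of the vertices number at least [L / 2]. *)
have many j q s : (j <= T)%N -> (0 < s)%N ->
    (L * (n - q * s) <= j.+1 * n)%N -> (s * L <= n)%N -> (m <= q)%N.
  move=> jT s_gt0 /(half _ _ jT) nq sL.
  have : (s * L <= s * (2 * q))%N
    by rewrite (leq_trans sL) // (leq_trans nq) // mulnA mulnC.
  by rewrite leq_pmul2l //; lia.
(* Either the goal [G] is already reached or [i] gains have been made. The indices [i.+1] count the
   initial cut of the trivial partition, a round without a required gain. *)
have state i : (i <= T)%N -> G \/ exists (Q : {set {set V}}) (s : nat),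
    [/\ [/\ trivIset Q, forall A, A \in Q -> #|A| = s & (0 < s)%N],
        (L * (n - #|Q| * s) <= i.+1 * n)%N, (#|Q| <= class_bound L i.+1)%N,
        (m <= #|Q|)%N & i%:R * (c * n%:R ^+ 2) <= energy w K (pair_label Q)].
  elim: i => [_ | i IHi iT].
    right; have tQ : trivIset [set [set: V]].
      by apply/trivIsetP=> A B; rewrite !inE => /eqP-> /eqP->; rewrite eqxx.
    have sQ A : A \in [set [set: V]] -> #|A| = n.
      by rewrite inE => /eqP->; rewrite cardsT.
    have [||Q [s [[tQ' sQ' s_gt0] lQ kQ sL _]]] :=
      increment_step eps_gt0 w_ge0 w_sum tQ sQ n_gt0 L_gt0; rewrite ?cards1.
    - by rewrite -/n; lia.
    - by apply: (enough_room 0%N) => //; apply: (leq_class_bound (i := 0%N)).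
    have {}lQ : (L * (n - #|Q| * s) <= 1 * n)%N.
      by apply: leq_trans lQ _; rewrite cards1 mul1n subnn muln0.
    exists Q, s; split => //.
    + by apply: leq_trans kQ _; rewrite cards1.
    + exact: (many 0%N _ s).
    + by rewrite mul0r; apply: energy_ge0; apply: ltW.
  have iT' : (i <= T)%N by apply: ltnW.
  have [|[Q [s [[tQ sQ s_gt0] lQ kQ mQ enQ]]]] := IHi iT'; first by left.
  have [irr | irr] := leP (#|irregular_in w eps Q|%:R) (eps * #|Q|%:R ^+ 2).
    left; exists Q, s; split => //.
      by rewrite mQ (leq_trans kQ) ?leq_class_bound // ltnS ltnW.
    rewrite cardsCs setCK (card_cover_uniform tQ sQ) -/n.
    rewrite -(ltr_pM2l (_ : 0 < L%:R :> R)) ?ltr0n //.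
    apply: (@le_lt_trans _ _ (T.+1%:R * n%:R)).
      rewrite -!natrM ler_nat (leq_trans lQ) // leq_mul2r ltnS iT' orbT //.
    by rewrite mulrA [L%:R * _]mulrC ltr_pM2r ?ltr0n.
  have nQ : (n <= 2 * #|Q| * s)%N by rewrite -mulnA; apply: half lQ.
  have [Q' [s' [[tQ' sQ' s'_gt0] lQ' kQ' sL gain]]] :=
    increment_step eps_gt0 w_ge0 w_sum tQ sQ n_gt0 L_gt0 nQ
      (enough_room _ _ iT' kQ).
  right; exists Q', s'.
  have {}lQ' : (L * (n - #|Q'| * s') <= i.+2 * n)%N.
    by apply: leq_trans lQ' _; rewrite -/n [(i.+2 * n)%N]mulSn addnC leq_add2l.
  split => //.
  - by apply: leq_trans kQ' _; apply: class_bound_step.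
  - exact: (many i.+1 _ s').
  - rewrite -[i.+1]addn1 natrD mulrDl mul1r; apply: le_trans (gain irr).
    by rewrite lerD2r.
have [//|[Q [s [_ _ _ _ enQ]]]] := state T (leqnn _).
have := le_trans enQ (energy_le K (pair_label Q) w_ge0).
have n2 : 0 < n%:R ^+ 2 :> R by rewrite exprn_gt0 ?ltr0n.
move=> /le_trans/(_ (ler_wpM2l (ltW (mulr_gt0 (ltr0n R 2) K_gt0)) w_sum)).
by rewrite mulrA ler_pM2r // leNgt T_large.
Qed.

(** * From weights to graphs *)

Lemma set2_eq_cases (V : finType) (a b x y : V) :
  [set x; y] = [set a; b] -> (x, y) \in [set (a, b); (b, a)].
Proof.
move=> e.
have : x \in [set a; b] by rewrite -e set21.
have : y \in [set a; b] by rewrite -e set22.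
have : a \in [set x; y] by rewrite e set21.
have : b \in [set x; y] by rewrite e set22.
rewrite !inE !xpair_eqE.
by do 4!case/orP=> /eqP ?; subst; rewrite ?eqxx ?orbT.
Qed.

Section GraphWeight.
Variables (V : finType) (E : rel V).

Lemma edges_betweenE (X Y : {set V}) : edges_between E X Y =
  [set [set u.1; u.2] | u in [set u in setX X Y | E u.1 u.2]].
Proof.
apply/setP=> e; apply/imset2P/imsetP => [[x y xX]|[[x y]]].
  by rewrite inE => /andP[yY xy] ->; exists (x, y); rewrite // !inE xX yY.
by rewrite !inE => /andP[/andP[xX yY] xy] ->; exists x y; rewrite // inE yY.
Qed.

(** An edge between disjoint sets has only one orientation from [X] to [Y]. *)
Lemma card_edges_between (X Y : {set V}) : [disjoint X & Y] ->
  #|edges_between E X Y| = #|[set u in setX X Y | E u.1 u.2]|.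
Proof.
move=> dXY; rewrite edges_betweenE; apply: card_in_imset => -[x y] [a b].
rewrite !inE /= => /andP[/andP[xX yY] _] /andP[/andP[aX bY] _] /set2_eq_cases.
rewrite !inE => /orP[/eqP//|/eqP[xb _]].
by move: (disjointFr dXY xX); rewrite xb bY.
Qed.

Lemma card_adjacent_pairs : (#|[set u | E u.1 u.2]| <= 2 * #|edges E|)%N.
Proof.
have -> : edges E = [set [set u.1; u.2] | u in [set u | E u.1 u.2]].
  rewrite /edges edges_betweenE (_ : [set u in _ | _] = [set u | E u.1 u.2]) //.
  by apply/setP=> u; rewrite !inE.
set A := [set u | _]; rewrite mulnC -sum_nat_const -sum1_card.
rewrite (partition_big_imset (fun u => [set u.1; u.2])) /=.
apply: leq_sum => _ /imsetP[[a b] _ ->]; rewrite sum1_card.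
apply: (@leq_trans #|[set (a, b); (b, a)]|); last first.
  by rewrite cards2; case: (_ != _).
apply/subset_leq_card/subsetP=> -[x y]; rewrite unfold_in => /andP[_ /eqP].
exact: set2_eq_cases.
Qed.

Variable R : realType.

Definition graph_weight (u : V * V) : R := (E u.1 u.2)%:R / density E R.

Lemma sum_graph_weight (A : {set V * V}) :
  \sum_(u in A) graph_weight u = #|[set u in A | E u.1 u.2]|%:R / density E R.
Proof.
rewrite -mulr_suml -natr_sum -sum1_card big_mkcond [in RHS]big_mkcond /=.
congr (_%:R / _); apply: eq_bigr => u _; rewrite inE.
by case: (u \in A); case: (E _ _).
Qed.

Lemma pair_density_weight (X Y : {set V}) : density E R != 0 ->
    [disjoint X & Y] ->
  pair_density E R X Y = rect_mean graph_weight (X, Y) * density E R.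
Proof.
move=> d0 dXY; rewrite /pair_density /rect_mean /mean.
rewrite sum_graph_weight cardsX natrM /=.
by rewrite card_edges_between // mulrAC divfK.
Qed.

Lemma irregular_of_regular_pair (eps : R) (X Y : {set V}) :
    0 < density E R -> [disjoint X & Y] ->
  ~~ regular_pair E eps (density E R) X Y -> irregular graph_weight eps (X, Y).
Proof.
move=> d0 dXY /forallPn[X' /forallPn[Y']].
rewrite negb_imply => /andP[/and4P[sX sY bX bY]]; rewrite -leNgt => dev.
apply/existsP; exists (X', Y'); rewrite /irregular_witness /= sX sY bX bY /=.
have dXY' := disjointWl sX (disjointWr sY dXY).
move: dev; rewrite !pair_density_weight ?gt_eqF // -mulrBl normrM.
by rewrite (gtr0_norm d0) ler_pM2r.
Qed.

End GraphWeight.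

Lemma density_gt0 (R : realType) (V : finType) (E : rel V) :
  irreflexive E -> edges E != set0 -> 0 < density E R.
Proof.
move=> irE E0; rewrite divr_gt0 // ltr0n ?card_gt0 // bin_gt0.
case/set0Pn: E0 => _ /imset2P[x y _ /[!inE] /andP[_ xy] _].
apply: leq_trans (max_card [set x; y]); rewrite cards2.
by case: eqP xy => // ->; rewrite irE.
Qed.

(** At most two ordered pairs per edge give total weight at most [2 * 'C(#|V|, 2)], which is at most
    [#|V| ^ 2]. *)
Lemma sum_graph_weight_le (R : realType) (V : finType) (E : rel V) :
  0 < density E R -> \sum_u graph_weight E R u <= #|V|%:R ^+ 2.
Proof.
move=> d0; have -> : \sum_u graph_weight E R u =
    \sum_(u in setT) graph_weight E R u.
  by apply: eq_bigl => u; rewrite inE.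
rewrite sum_graph_weight ler_pdivrMr // /density mulrA.
have C0 : (0 < 'C(#|V|, 2))%N.
  by rewrite lt0n; apply/eqP => C0; move: d0; rewrite /density C0 invr0 mulr0 ltxx.
rewrite ler_pdivlMr ?ltr0n // -natrX -!natrM ler_nat.
have -> : [set u in [set: V * V] | E u.1 u.2] = [set u | E u.1 u.2].
  by apply/setP=> u; rewrite !inE.
have C2 : (2 * 'C(#|V|, 2) <= #|V| ^ 2)%N.
  rewrite bin2 mul2n; apply: (@leq_trans (#|V| * #|V|.-1)).
    by rewrite -[leqRHS]odd_double_half leq_addl.
  by rewrite -mulnn leq_mul2l leq_pred orbT.
apply: leq_trans (leq_mul (card_adjacent_pairs E) (leqnn _)) _.
by rewrite mulnAC leq_mul2r C2 orbT.
Qed.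

(** * Numbered classes and the theorem for graphs *)

Section Enumerate.
Variables (V : finType) (Q : {set {set V}}).

Definition enum_partition (i : 'I_#|Q|.+1) : {set V} :=
  if unlift ord0 i is Some j then enum_val j else ~: cover Q.

Lemma enum_partition_lift j : enum_partition (lift ord0 j) = enum_val j.
Proof. by rewrite /enum_partition liftK. Qed.

Lemma enum_partition0 : enum_partition ord0 = ~: cover Q.
Proof. by rewrite /enum_partition unlift_none. Qed.

Lemma enum_partition_in i : i != ord0 -> enum_partition i \in Q.
Proof.
by rewrite eq_sym => /unlift_some[j -> _]; rewrite enum_partition_lift enum_valP.
Qed.

Lemma enum_partition_inj : {in [pred i | i != ord0] &, injective enum_partition}.
Proof.
move=> i j; rewrite !inE ![_ == ord0]eq_sym.
move=> /unlift_some[i' -> _] /unlift_some[j' -> _].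
by rewrite !enum_partition_lift => /enum_val_inj->.
Qed.

Lemma enum_partition_exceptional :
  trivIset Q -> set0 \notin Q -> exceptional_partition enum_partition.
Proof.
move=> tQ Q0; split.
- apply/setP=> x; rewrite inE; apply/bigcupP.
  have [/bigcupP[A AQ xA] | xQ] := boolP (x \in cover Q).
    exists (lift ord0 (enum_rank_in AQ A)) => //.
    by rewrite enum_partition_lift enum_rankK_in.
  by exists ord0 => //; rewrite enum_partition0 inE.
- have disj0 i : i != ord0 -> [disjoint enum_partition i & ~: cover Q].
    by move=> /enum_partition_in iQ; rewrite disjoints_subset setCK (bigcup_max _ iQ).
  move=> i j ij; have [i0|i0] := eqVneq i ord0.
    by rewrite i0 enum_partition0 disjoint_sym disj0 // -i0 eq_sym.
  have [->|j0] := eqVneq j ord0; first by rewrite enum_partition0 disj0.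
  move/trivIsetP: tQ; apply; rewrite ?enum_partition_in //.
  by apply: contra_neq ij; apply: enum_partition_inj.
- by move=> i /enum_partition_in iQ; apply: contraNneq Q0 => <-.
Qed.

End Enumerate.

Theorem theorem5 (R : realType) (eps : R) (m : nat)
    (eps_gt0 : 0 < eps) (m_gt0 : (0 < m)%N) :
  exists M : nat, (0 < M)%N /\
    forall (V : finType) (E : rel V),
      symmetric E -> irreflexive E -> edges E != set0 -> (M <= #|V|)%N ->
      exists (k : nat) (P : 'I_k.+1 -> {set V}),
        regular_partition E eps P /\ (m <= k <= M)%N.
Proof.
have [M wreg] := @weighted_regularity R eps m eps_gt0.
(* The successor makes the bound positive and rules out an empty vertex set. *)
exists M.+1; split=> // V E _ irE E0 MV.
have d0 := density_gt0 R irE E0.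
have w0 u : 0 <= graph_weight E R u by rewrite divr_ge0 // ltW.
have [||Q [s [[tQ sQ s_gt0] /andP[mQ QM] exc irr]]] :=
  wreg V _ w0 (sum_graph_weight_le d0).
- exact: ltnW.
- exact: leq_ltn_trans MV.
have P_part : exceptional_partition (@enum_partition V Q).
  apply: enum_partition_exceptional => //.
  by apply/negP => /sQ; rewrite cards0 => s0; rewrite -s0 in s_gt0.
exists #|Q|, (@enum_partition V Q); split; last by rewrite mQ (leq_trans QM).
split=> //.
- by move=> i j i0 j0; rewrite !(sQ _ (enum_partition_in _)).
- by rewrite enum_partition0.
apply: le_trans irr; rewrite ler_nat.
(* Index pairs with [0 < j < i] inject into ordered pairs of blocks, which are the pairs counted by
   [irregular_in]. *)
rewrite -(card_in_imset
  (f := fun ij => (enum_partition ij.1, enum_partition ij.2))).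
  apply/subset_leq_card/subsetP=> _ /imsetP[[i j] + ->].
  rewrite !inE /= => /andP[/andP[j0 ji] nreg].
  have {}j0 : j != ord0 by rewrite -lt0n.
  have i0 : i != ord0 by rewrite -lt0n (leq_ltn_trans _ ji).
  rewrite !enum_partition_in //=; apply: irregular_of_regular_pair nreg => //.
  by apply: (expart_disjoint P_part); apply: contraTneq ji => ->; rewrite ltnn.
move=> [i j] [i' j']; rewrite !inE /=.
move=> /andP[/andP[j0 ji] _] /andP[/andP[j0' ji'] _].
have nz (l : 'I_#|Q|.+1) : (0 < l)%N -> l \in [pred i | i != ord0].
  by rewrite inE -lt0n.
case=> /enum_partition_inj ei /enum_partition_inj ej.
have i_gt0 := leq_ltn_trans (leq0n _) ji.
have i'_gt0 := leq_ltn_trans (leq0n _) ji'.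
by rewrite (ei (nz _ i_gt0) (nz _ i'_gt0)) (ej (nz _ j0) (nz _ j0')).
Qed.
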